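(* Let $(\Gamma,G,\Lambda)$ be a splitting crystal triple in $\mathbb{R}^d$, $r=|G|$, $G=\{g_1=\mathrm{Id},g_2,\dots,g_r\}$, let $a$ be a $\Gamma$-admissible matrix, let $\phi\in L^2(\mathbb{R}^d)$, and let $\{\mathcal{V}_j\}_{j\in\mathbb{Z}}$ be the subspaces generated by $\phi$, i.e. $\mathcal{V}_0=\overline{\mathrm{span}}\{D_\gamma\phi\}_{\gamma\in\Gamma}$ and $\mathcal{V}_j=\{f(a^j\,\cdot\,):f\in\mathcal{V}_0\}$. Then $\{\mathcal{V}_j\}_{j\in\mathbb{Z}}$ is a $(\Gamma,a)$-MRA of multiplicity $1$ with crystal-scaling function $\phi$ if and only if the function $\Phi:\mathbb{R}^d\to\mathbb{C}^r$ defined by $$\Phi(x)=(\phi\circ g_1^{-1}(x),\dots,\phi\circ g_r^{-1}(x))^T$$ is the scaling vector function for a (classical) MRA of multiplicity $r$ (with respect to the lattice $\Lambda$ and the dilation $a$), and the coefficients $c_k\in\mathbb{C}^{r\times r}$ of the refinement equation $\Phi(x)=\sum_{k\in\Lambda}c_k\Phi(ax-k)$ of $\Phi$ have $(\Gamma,a)$-symmetry.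
   Context: A crystal group is a discrete subgroup $\Gamma$ of the isometry group of $\mathbb{R}^d$ admitting a compact fundamental domain. Then $\Lambda=\Gamma\cap\{\text{translations}\}$ consists of the translations by the vectors of a full rank lattice, also denoted $\Lambda$, and the point group $G\cong\Gamma/\Lambda$ (the linear parts of elements of $\Gamma$) is a finite subgroup of $O(d)$ with $g(\Lambda)=\Lambda$ for $g\in G$; $(\Gamma,G,\Lambda)$ is a crystal triple. It is splitting if $\Gamma=G\ltimes\Lambda$; then elements are $\gamma=(g,k)$, $g\in G$, $k\in\Lambda$, acting by $\gamma(x)=g(x+k)$. A matrix $a$ is $\Gamma$-admissible if all its eigenvalues have modulus larger than $1$ and $a\Gamma a^{-1}\subset\Gamma$. Standing assumptions: $a$ admits a set of digits $\{d_0,\dots,d_{m-1}\}$ (representatives of $\Lambda/a\Lambda$, $m=|\det a|$) such that the unique compact set $\mathcal{Q}$ with $a(\mathcal{Q})=\bigcup_s(\mathcal{Q}+d_s)$ is a tiling of $\mathbb{R}^d$, i.e. $\{\mathcal{Q}+\lambda\}_{\lambda\in\Lambda}$ covers $\mathbb{R}^d$; and only finitely many coefficients of the refinement equations considered are non-zero. For an invertible affine map $\gamma$ with linear part $\mathrm{lin}(\gamma)$, $D_\gamma f(x)=|\det\mathrm{lin}(\gamma)|^{-1/2}f(\gamma^{-1}x)$. A $(\Gamma,a)$-MRA of multiplicity $n$ is a sequence $\{\mathcal{V}_j\}_{j\in\mathbb{Z}}$ of closed subspaces of $L^2(\mathbb{R}^d)$ with: (i) $\mathcal{V}_j\subset\mathcal{V}_{j+1}$;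 (ii) $\mathcal{V}_{j+1}=D_a^{-1}\mathcal{V}_j$; (iii) $\bigcap_j\mathcal{V}_j=\{0\}$ and $\overline{\bigcup_j\mathcal{V}_j}=L^2(\mathbb{R}^d)$; (iv) there are $\phi_1,\dots,\phi_n\in L^2(\mathbb{R}^d)$ (the crystal-scaling function vector) such that $\{D_\gamma\phi_i:\gamma\in\Gamma,\ i=1,\dots,n\}$ is an orthonormal basis of $\mathcal{V}_0$. A classical MRA of multiplicity $n$ is the case in which $\Gamma$ is replaced by the translation group $\Lambda$; $(\phi_1,\dots,\phi_n)$ is then called its scaling vector function. $(\Gamma,a)$-symmetry: matrices $c_k=(c_{i,j}^k)\in\mathbb{C}^{r\times r}$, $k\in\Lambda$, have $(\Gamma,a)$-symmetry if $c_{i,j}^k=c_{1,\rho_i(j)}^{g_{h_i}^{-1}(k)}$ for all $i,j=1,\dots,r$ and $k\in\Lambda$, where $g_{h_i}=ag_ia^{-1}$ and $\rho_i$ is the permutation with $g_{\rho_i(j)}=g_{h_i}^{-1}g_j$. *)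

(* Defs.v *)
From HB Require Import structures.
From mathcomp Require Import all_boot all_order all_algebra all_fingroup.
From mathcomp Require Import all_classical all_reals all_analysis.
From mathcomp Require Import finmap complex.

Set Implicit Arguments.
Unset Strict Implicit.
Unset Printing Implicit Defensive.

Import Order.TTheory GRing.Theory Num.Theory.
Import numFieldTopology.Exports numFieldNormedType.Exports.

Local Open Scope classical_set_scope.
Local Open Scope ring_scope.
Local Open Scope complex_scope.

Definition cV_display : measure_display.
Proof. exact: default_measure_display. Qed.

Section measurable_cV.
Variables (R : realType) (n : nat).

Definition coord (i : 'I_n) (x : 'cV[R]_n) : R := x i ord0.

Let cV_set0 : g_sigma_preimage coord set0.
Proof. exact: sigma_algebra0. Qed.

Let cV_setC A : g_sigma_preimage coord A -> g_sigma_preimage coord (~` A).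
Proof. exact: sigma_algebraC. Qed.

Let cV_bigcup (F : _^nat) : (forall i, g_sigma_preimage coord (F i)) ->
  g_sigma_preimage coord (\bigcup_i (F i)).
Proof. exact: sigma_algebra_bigcup. Qed.

(* The coordinate-generated sigma-algebra, i.e. the Borel sets of R^n. *)
HB.instance Definition _ := @isMeasurable.Build cV_display 'cV[R]_n
  (g_sigma_preimage coord) cV_set0 cV_setC cV_bigcup.

End measurable_cV.

Section measurable_cV_theory.
Variable R : realType.

Lemma measurable_coord n (i : 'I_n) : measurable_fun setT (@coord R n i).
Proof.
move=> _ Y mY; rewrite setTI; apply: sub_sigma_algebra => /=.
rewrite -bigcup_seq/=; exists i => /=; first by rewrite mem_index_enum.
by exists Y => //; rewrite setTI.
Qed.

Lemma measurable_fun_coordP d (T : measurableType d) n (f : T -> 'cV[R]_n) :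
  measurable_fun setT f <-> forall i, measurable_fun setT (coord i \o f).
Proof.
split=> [mf i|mf]; first exact: measurableT_comp (measurable_coord i) mf.
suff : g_sigma_preimage (fun i => coord i \o f) `<=` measurable.
  rewrite g_sigma_preimage_comp => prefS _ A mA.
  by apply: prefS; exists A.
apply: smallest_sub; first exact: sigma_algebra_measurable.
case: n => [|n] in f mf *; first by rewrite big_ord0.
rewrite -bigcup_mkord_ord; apply: bigcup_sub => i Ii.
by move=> A [B mB <-]; exact: mf.
Qed.

Definition cV_cons n (p : R * 'cV[R]_n) : 'cV[R]_n.+1 :=
  col_mx (p.1%:M : 'cV_1) p.2.

Definition cV_uncons n (x : 'cV[R]_n.+1) : R * 'cV[R]_n :=
  (x ord0 ord0, \col_i x (lift ord0 i) ord0).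

Lemma coord0_cons n (p : R * 'cV[R]_n) : cV_cons p ord0 ord0 = p.1.
Proof.
have e : ord0 = lshift n (ord0 : 'I_1) by exact/val_inj.
by rewrite e; apply: (etrans (col_mxEu _ _ _ _)); rewrite mxE.
Qed.

Lemma coordS_cons n (p : R * 'cV[R]_n) i :
  cV_cons p (lift ord0 i) ord0 = p.2 i ord0.
Proof.
have -> : lift ord0 i = rshift 1 i by exact/val_inj.
exact: (etrans (col_mxEd _ _ _ _)).
Qed.

Lemma cV_consK n : cancel (@cV_cons n) (@cV_uncons n).
Proof.
move=> [r x]; rewrite /cV_uncons coord0_cons; congr pair.
by apply/colP => i; rewrite mxE coordS_cons.
Qed.

Lemma cV_unconsK n : cancel (@cV_uncons n) (@cV_cons n).
Proof.
move=> x; apply/colP => i; case: (unliftP ord0 i) => [j ->|->].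
  by rewrite coordS_cons mxE.
by rewrite coord0_cons.
Qed.

Lemma measurable_cV_cons n : measurable_fun setT (@cV_cons n).
Proof.
apply/measurable_fun_coordP => i; case: (unliftP ord0 i) => [j ->|->].
  rewrite [_ \o _](_ : _ = coord j \o snd).
    exact: measurableT_comp (measurable_coord j) measurable_snd.
  by apply/funext => p; rewrite /= /coord coordS_cons.
rewrite [_ \o _](_ : _ = fst); first exact: measurable_fst.
by apply/funext => p; rewrite /= /coord coord0_cons.
Qed.

Lemma measurable_cV_uncons n : measurable_fun setT (@cV_uncons n).
Proof.
apply/measurable_fun_pairP; split; first exact: (measurable_coord ord0).
apply/measurable_fun_coordP => i.
rewrite [_ \o _](_ : _ = coord (lift ord0 i)); first exact: measurable_coord.
by apply/funext => x; rewrite /= /coord mxE.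
Qed.

End measurable_cV_theory.

Section lebesgue_cV.
Variable R : realType.
Local Open Scope ereal_scope.

Section step.
Variables (n : nat) (mu : {sigma_finite_measure set 'cV[R]_n -> \bar R}).

Definition lebesgue_cons : set 'cV[R]_n.+1 -> \bar R :=
  pushforward ((@lebesgue_measure R) \x mu) (@cV_cons R n).

Let lebesgue_cons0 : lebesgue_cons set0 = 0.
Proof. by rewrite /lebesgue_cons /pushforward preimage_set0 measure0. Qed.

Let lebesgue_cons_ge0 A : 0 <= lebesgue_cons A.
Proof. by rewrite /lebesgue_cons /pushforward; exact: measure_ge0. Qed.

Let lebesgue_cons_additive : semi_sigma_additive lebesgue_cons.
Proof.
move=> F mF tF mUF.
have mC A : measurable A -> measurable (@cV_cons R n @^-1` A).
  by move=> mA; rewrite -[X in measurable X]setTI; exact: measurable_cV_cons.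
rewrite /lebesgue_cons /pushforward preimage_bigcup.
apply: measure_semi_sigma_additive.
- by move=> k; exact: mC.
- apply/trivIsetP => /= i j _ _ ij; rewrite -preimage_setI.
  by move/trivIsetP : tF => /(_ _ _ _ _ ij) ->//; rewrite preimage_set0.
- by rewrite -preimage_bigcup; exact: mC.
Qed.

HB.instance Definition _ := isMeasure.Build _ _ _ lebesgue_cons
  lebesgue_cons0 lebesgue_cons_ge0 lebesgue_cons_additive.

Let lebesgue_cons_sigma_finite : sigma_finite setT lebesgue_cons.
Proof.
have /sigma_finiteP[F [TF ndF Foo]] := @sigma_finiteT _ _ _ (@lebesgue_measure R).
have /sigma_finiteP[G [TG ndG Goo]] := sigma_finiteT mu.
exists (fun k => @cV_uncons R n @^-1` (F k `*` G k)) => [|k].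
  rewrite -preimage_bigcup (_ : \bigcup_k _ = setT) ?preimage_setT//.
  apply/seteqP; split=> // -[r x] _.
  have [k1 _ Fk1] : (\bigcup_k F k) r by rewrite -TF.
  have [k2 _ Gk2] : (\bigcup_k G k) x by rewrite -TG.
  exists (maxn k1 k2) => //; split => /=.
    by move: r Fk1; exact/subsetPset/ndF/leq_maxl.
  by move: x Gk2; exact/subsetPset/ndG/leq_maxr.
have [? ?] := Foo k; have [? ?] := Goo k; split.
  rewrite -[X in measurable X]setTI; apply: measurable_cV_uncons => //.
  exact: measurableX.
rewrite /lebesgue_cons /pushforward -comp_preimage.
rewrite (_ : _ \o _ = id); last by apply/funext => p /=; exact: cV_consK.
by rewrite preimage_id product_measure1E// lte_mul_pinfty// ge0_fin_numE.
Qed.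

HB.instance Definition _ := Measure_isSigmaFinite.Build _ _ _ lebesgue_cons
  lebesgue_cons_sigma_finite.

End step.

(* Lebesgue measure on R^n, as the n-fold product of the one-dimensional one
   (the point mass when n = 0). *)
Fixpoint lebesgue_cV (n : nat) : {sigma_finite_measure set 'cV[R]_n -> \bar R} :=
  if n is m.+1 then lebesgue_cons (lebesgue_cV m) else @dirac _ 'cV[R]_0 0%R R.

Lemma lebesgue_cV_box n (A : 'I_n -> set R) : (forall i, measurable (A i)) ->
  lebesgue_cV n [set x : 'cV[R]_n | forall i, A i (x i ord0)] =
  \prod_(i < n) (@lebesgue_measure R) (A i).
Proof.
elim: n A => [A _|n IH A mA].
  rewrite big_ord0 (_ : [set x : 'cV[R]_0 | _] = setT).
    by rewrite /= diracT.
  by apply/seteqP; split => // x _ [].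
rewrite big_ord_recl /= /lebesgue_cons /pushforward.
set B := _ @^-1` _.
have -> : B = A ord0 `*` [set x : 'cV[R]_n | forall i, A (lift ord0 i) (x i ord0)].
  apply/seteqP; split=> [[r x]|[r x]] /=.
    move=> H; split; first by have := H ord0; rewrite coord0_cons.
    by move=> i; have := H (lift ord0 i); rewrite coordS_cons.
  case=> /= H0 HS i; case: (unliftP ord0 i) => [j ->|->].
    by rewrite coordS_cons.
  by rewrite coord0_cons.
rewrite product_measure1E//; [|exact: mA|].
  by congr (_ * _); rewrite -(IH (fun i => A (lift ord0 i))).
rewrite [X in measurable X](_ : _ =
    \bigcap_(i in [set: 'I_n]) (coord i @^-1` A (lift ord0 i))).
  apply: fin_bigcap_measurable => // i _.
  by rewrite -[X in measurable X]setTI; exact: measurable_coord.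
by apply/seteqP; split=> x /= H i; [move=> _; exact: H|exact: (H i)].
Qed.

End lebesgue_cV.

Section L2.
Variables (R : realType) (n : nat).
Local Notation fn := ('cV[R]_n -> R[i]).

(* Classes in L^2(R^n) are represented by Borel functions; subspaces are sets
   of such functions that are stable under a.e. equality inside L2. *)

Definition L2normsq (f : fn) : \bar R :=
  (\int[lebesgue_cV R n]_x (complex.Re (f x) ^+ 2 + complex.Im (f x) ^+ 2)%:E)%E.

Definition L2 : set fn :=
  [set f | [/\ measurable_fun setT (fun x => complex.Re (f x)),
               measurable_fun setT (fun x => complex.Im (f x)) &
               (L2normsq f < +oo)%E]].

Definition L2dot (f g : fn) : R[i] :=
  Rintegral (lebesgue_cV R n) setT (fun x => complex.Re (f x * (g x)^*)) +i*
  Rintegral (lebesgue_cV R n) setT (fun x => complex.Im (f x * (g x)^*)).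

Definition L2closure (E : set fn) : set fn :=
  [set f | L2 f /\ forall e : R, 0 < e ->
     exists2 g, E g & (L2normsq (fun x => f x - g x)%R < (e ^+ 2)%:E)%E].

Definition lin_span (E : set fn) : set fn :=
  [set f | exists (m : nat) (c : 'I_m -> R[i]) (u : 'I_m -> fn),
     (forall i, E (u i)) /\ f = (fun x => \sum_i c i * u i x)].

Definition closed_subspace (V : set fn) : Prop :=
  [/\ V `<=` L2, V (fun=> 0),
      forall (c : R[i]) f g, V f -> V g -> V (fun x => c * f x + g x) &
      L2closure V `<=` V].

End L2.

(* The pair (A, v) stands for the affine map x |-> A x + v. *)
Notation aff R n := ('M[R]_n * 'cV[R]_n)%type.

Section affine.
Variables (R : realType) (n : nat).
Implicit Types (s t : aff R n).

Definition aff_act s (x : 'cV[R]_n) : 'cV[R]_n := s.1 *m x + s.2.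
Definition aff_one : aff R n := (1%:M, 0).
Definition aff_mul s t : aff R n := (s.1 *m t.1, s.1 *m t.2 + s.2).
Definition aff_inv s : aff R n := (invmx s.1, - (invmx s.1 *m s.2)).
Definition aff_lin (A : 'M[R]_n) : aff R n := (A, 0).

Definition Dop s (f : 'cV[R]_n -> R[i]) : 'cV[R]_n -> R[i] :=
  fun x => ((Num.sqrt `|\det s.1|)^-1)%:C * f (aff_act (aff_inv s) x).

(* The library norm on matrices is the sup norm, not the Euclidean one. *)
Definition euclid_norm (x : 'cV[R]_n) : R := Num.sqrt (\sum_i x i ord0 ^+ 2).

Definition is_isometry s : Prop :=
  forall x y, euclid_norm (aff_act s x - aff_act s y) = euclid_norm (x - y).

Definition fundamental_domain (Gam : set (aff R n)) (K : set 'cV[R]_n) : Prop :=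
  \bigcup_(s in Gam) (aff_act s @` K) = setT /\
  forall s, Gam s -> s <> aff_one -> interior (aff_act s @` K) `&` interior K = set0.

Record crystal_group (Gam : set (aff R n)) : Prop := CrystalGroup {
  crystal_isometry : forall s, Gam s -> is_isometry s;
  crystal_one : Gam aff_one;
  crystal_mul : forall s t, Gam s -> Gam t -> Gam (aff_mul s t);
  crystal_inv : forall s, Gam s -> Gam (aff_inv s);
  crystal_discrete : forall s, Gam s -> \forall t \near s, Gam t -> t = s;
  crystal_compact : exists2 K, compact K & fundamental_domain Gam K }.

(* That Lam is a full rank lattice and G a finite subgroup of O(n) with
   g(Lam) = Lam is a theorem about crystal groups, not part of the definition. *)
Definition crystal_triple (Gam : set (aff R n)) (G : set 'M[R]_n)
    (Lam : set 'cV[R]_n) : Prop :=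
  [/\ crystal_group Gam, Lam = [set k | Gam (1%:M, k)] & G = [set s.1 | s in Gam]].

(* (g, g k) is the map x |-> g (x + k). *)
Definition splitting_crystal_triple (Gam : set (aff R n)) (G : set 'M[R]_n)
    (Lam : set 'cV[R]_n) : Prop :=
  crystal_triple Gam G Lam /\
  Gam = [set s | exists g k, [/\ G g, Lam k & s = (g, g *m k)]].

Definition translations (Lam : set 'cV[R]_n) : set (aff R n) :=
  [set (1%:M, k) | k in Lam].

Definition admissible (Gam : set (aff R n)) (a : 'M[R]_n) : Prop :=
  (forall z : R[i], eigenvalue (map_mx (fun t : R => t%:C) a) z -> 1 < `|z|) /\
  (forall s, Gam s ->
     Gam (aff_mul (aff_lin a) (aff_mul s (aff_inv (aff_lin a))))).

Definition digit_set (Lam : set 'cV[R]_n) (a : 'M[R]_n) (m : nat)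
    (dig : 'I_m -> 'cV[R]_n) : Prop :=
  [/\ m%:R = `|\det a|, forall i, Lam (dig i) &
      forall k, Lam k -> exists! i, exists2 l, Lam l & k - dig i = a *m l].

(* By Hutchinson's theorem Q is determined by the first three conditions. *)
Definition admits_tiling_digits (Lam : set 'cV[R]_n) (a : 'M[R]_n) : Prop :=
  exists (m : nat) (dig : 'I_m -> 'cV[R]_n), digit_set Lam a dig /\
  exists Q : set 'cV[R]_n,
    [/\ compact Q, Q !=set0,
        mulmx a @` Q = \bigcup_(i in setT) [set x + dig i | x in Q] &
        \bigcup_(l in Lam) [set x + l | x in Q] = setT].

End affine.

Section MRA.
Variables (R : realType) (n : nat).
Local Notation fn := ('cV[R]_n -> R[i]).

Definition orbit_family (Gam : set (aff R n)) (N : nat) (phi : 'I_N -> fn) : set fn :=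
  [set f | exists i s, Gam s /\ f = Dop s (phi i)].

Definition orthonormal_orbit (Gam : set (aff R n)) (N : nat)
    (phi : 'I_N -> fn) : Prop :=
  forall i j s t, Gam s -> Gam t ->
    L2dot (Dop s (phi i)) (Dop t (phi j)) = ((i == j) && (s == t))%:R.

Record is_MRA (Gam : set (aff R n)) (a : 'M[R]_n) (N : nat) (phi : 'I_N -> fn)
    (V : int -> set fn) : Prop := IsMRA {
  MRA_closed : forall j, closed_subspace (V j);
  MRA_nested : forall j, V j `<=` V (j + 1);
  MRA_dilation : forall j, V (j + 1) = Dop (aff_lin a) @^-1` V j;
  MRA_inter : \bigcap_(j in setT) V j =
    [set f | @L2 R n f /\ {ae lebesgue_cV R n, forall x, f x = 0}];
  MRA_dense : L2closure (\bigcup_(j in setT) V j) = @L2 R n;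
  MRA_scaling_L2 : forall i, @L2 R n (phi i);
  MRA_orthonormal : orthonormal_orbit Gam phi;
  MRA_span : V 0 = L2closure (lin_span (orbit_family Gam phi)) }.

(* Phi(x) = \sum_(k in Lam) c_k Phi(a x - k), the sum converging
   unconditionally in L^2, componentwise. *)
Definition refinement_equation (Lam : set 'cV[R]_n) (a : 'M[R]_n) (r : nat)
    (Phi : 'I_r -> fn) (c : 'cV[R]_n -> 'M[R[i]]_r) : Prop :=
  forall i (e : R), 0 < e ->
    exists F0 : {fset 'cV[R]_n}, [set` F0] `<=` Lam /\
    forall F : {fset 'cV[R]_n}, [set` F] `<=` Lam -> (F0 `<=` F)%fset ->
      (L2normsq (fun x => Phi i x -
         \sum_(k <- F) \sum_j c k i j * Phi j (a *m x - k))%R < (e ^+ 2)%:E)%E.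

Definition finitely_many_coefs (Lam : set 'cV[R]_n) (r : nat)
    (c : 'cV[R]_n -> 'M[R[i]]_r) : Prop :=
  finite_set [set k | Lam k /\ c k <> 0].

(* g lists the point group, ord0 being the index of the identity. *)
Definition Gam_a_symmetry (Lam : set 'cV[R]_n) (a : 'M[R]_n) (r : nat)
    (g : 'I_r.+1 -> 'M[R]_n) (c : 'cV[R]_n -> 'M[R[i]]_r.+1) : Prop :=
  let gh i := a *m g i *m invmx a in
  exists rho : 'I_r.+1 -> {perm 'I_r.+1},
    (forall i j, g (rho i j) = invmx (gh i) *m g j) /\
    (forall i j k, Lam k -> c k i j = c (invmx (gh i) *m k) ord0 (rho i j)).

Definition rotated (r : nat) (g : 'I_r -> 'M[R]_n) (phi : fn) : 'I_r -> fn :=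
  fun i x => phi (invmx (g i) *m x).

End MRA.

(* Positive dimension, so that the integer power a ^ j lives in a unit ring. *)
Definition generated_spaces (R : realType) (d : nat) (Gam : set (aff R d.+1))
    (a : 'M[R]_d.+1) (phi : 'cV[R]_d.+1 -> R[i]) (j : int) :
    set ('cV[R]_d.+1 -> R[i]) :=
  [set (fun x => f (a ^ j *m x)) | f in
     L2closure (lin_span [set Dop s phi | s in Gam])].

(* Main.v *)
Require Import Defs.
From mathcomp Require Import all_boot all_order all_algebra all_fingroup.
From mathcomp Require Import finmap.
From mathcomp Require Import all_classical all_reals all_analysis.
From mathcomp Require Import measurable_realfun complex ring lra.

Set Implicit Arguments.
Unset Strict Implicit.
Unset Printing Implicit Defensive.

Import Order.TTheory GRing.Theory Num.Theory.
Import numFieldTopology.Exports numFieldNormedType.Exports.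

Local Open Scope classical_set_scope.
Local Open Scope ring_scope.

(** Write phi_i for phi o g_i^-1.  The element (g_i, g_i k) of Gamma acts on phi
    by D phi (x) = phi (g_i^-1 x - k) = phi_i (x - g_i k), because an isometry
    has determinant of modulus 1, and g_i permutes Lambda.  So the Gamma-orbit
    of phi and the Lambda-orbit of (phi_1, ..., phi_r) are the same family, with
    the same indexing (orbit_family_rotated, orthonormal_orbit_rotated).

    From right to left: an MRA is determined by V_0 and the dilation rule, hence
    any MRA whose scaling vector is Phi consists of the spaces generated by phi
    (MRA_generated), and it is at the same time a (Gamma, a)-MRA.

    From left to right the spaces are again the same, and a refinement equation
    with symmetric coefficients has to be produced.  Since phi lies in V_0, hence
    in V_1, phi = f o a for some f in V_0.  The coefficients of f in the
    orthonormal family of translates give the first row of the equation: the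
    Fourier expansion of f converges unconditionally by the best approximation
    property (fourier_expansion), and composing with a multiplies L^2 norms by a
    bounded factor (L2normsq_aff).  Row i then comes from the first row on
    composing with g_i^-1: as a g_i^-1 = g_{h_i}^-1 a, this substitution turns
    phi_{rho_i j} (a x - g_{h_i}^-1 k) into phi_j (a x - k), so the coefficients
    of row i are those of row 1 permuted exactly as (Gamma, a)-symmetry
    prescribes (symmetrized_refinement).  Finiteness is reached by running this
    symmetrization a second time, on the first row of a finite solution.

    The analytic input is that an invertible linear map scales the Lebesgue
    integral by a finite constant, whose value is immaterial.  As in the
    uniqueness of Haar measure, the constant comes out of translation invariance
    and Tonelli's theorem (integral_cV_mulmx). *)

(** * Measurability of affine maps *)

Section measurable_linear.
Variable R : realType.

Lemma measurable_cV_add d (T : measurableType d) n (f h : T -> 'cV[R]_n) :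
  measurable_fun setT f -> measurable_fun setT h ->
  measurable_fun setT (fun x => f x + h x).
Proof.
move=> /measurable_fun_coordP mf /measurable_fun_coordP mh.
apply/measurable_fun_coordP => i.
rewrite (_ : _ \o _ = (Defs.coord i \o f) \+ (Defs.coord i \o h)).
  exact: measurable_funD.
by apply/funext => x; rewrite /= /Defs.coord mxE.
Qed.

Lemma measurable_cV_mulmx d (T : measurableType d) m n (A : 'M[R]_(m, n))
    (f : T -> 'cV[R]_n) :
  measurable_fun setT f -> measurable_fun setT (fun x => A *m f x).
Proof.
move=> /measurable_fun_coordP mf; apply/measurable_fun_coordP => i.
rewrite (_ : _ \o _ = fun x => \sum_j A i j * (Defs.coord j \o f) x).
  by apply: measurable_sum => j; apply: measurable_funM.
by apply/funext => x; rewrite /= /Defs.coord mxE.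
Qed.

Lemma measurable_aff_act n (s : aff R n) : measurable_fun setT (aff_act s).
Proof. by apply: measurable_cV_add => //; apply: measurable_cV_mulmx. Qed.

End measurable_linear.

(** * Lebesgue integrals under translations and linear maps *)

Section translation.
Variable R : realType.
Local Open Scope ereal_scope.

Lemma integral_shift (f : R -> \bar R) (v : R) :
  measurable_fun setT f -> (forall x, 0 <= f x) ->
  \int[lebesgue_measure]_x f (x + v)%R = \int[lebesgue_measure]_x f x.
Proof.
move=> mf f0.
have mv : measurable_fun setT (fun x : measurableTypeR R => (x + v)%R : measurableTypeR R).
  exact: measurable_funD.
transitivity (\int[pushforward lebesgue_measure
    (fun x : measurableTypeR R => (x + v)%R : measurableTypeR R)]_x f x).
  by rewrite ge0_integral_pushforward.
apply: eq_measure_integral => A mA _; apply/esym/lebesgue_measure_unique => //=.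
move=> _ [[a b]] _ <-; rewrite /pushforward.
rewrite (_ : _ @^-1` _ = `](a - v)%R, (b - v)%R]%classic).
  rewrite !lebesgue_measure_itv/= !lte_fin ltrD2r.
  by rewrite -!EFinB opprB addrA subrK.
by apply/seteqP; split=> x /=; rewrite !in_itv/= ltrBlDr lerBrDr.
Qed.

Lemma integral_lebesgue_cVS n (f : 'cV[R]_n.+1 -> \bar R) :
  measurable_fun setT f -> (forall x, 0 <= f x) ->
  \int[lebesgue_cV R n.+1]_x f x =
  \int[lebesgue_measure]_r \int[lebesgue_cV R n]_x f (cV_cons (r, x)).
Proof.
move=> mf f0 /=.
transitivity (\int[(@lebesgue_measure R) \x lebesgue_cV R n]_p f (cV_cons p)).
  by rewrite ge0_integral_pushforward//; exact: measurable_cV_cons.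
rewrite (@fubini_tonelli1 _ _ _ _ R lebesgue_measure (lebesgue_cV R n))//.
by apply: measurableT_comp => //; exact: measurable_cV_cons.
Qed.

(** Induction on the dimension: the first coordinate is split off by Tonelli's
    theorem. *)
Lemma integral_cV_shift n (v : 'cV[R]_n) (f : 'cV[R]_n -> \bar R) :
  measurable_fun setT f -> (forall x, 0 <= f x) ->
  \int[lebesgue_cV R n]_x f (x + v)%R = \int[lebesgue_cV R n]_x f x.
Proof.
elim: n v f => [|n IH] v f mf f0.
  by apply: eq_integral => x _; congr f; apply/colP => -[].
have mfv : measurable_fun setT (fun x : 'cV[R]_n.+1 => f (x + v)%R).
  by apply: measurableT_comp => //; apply: measurable_cV_add.
rewrite !integral_lebesgue_cVS//.
pose v0 := v ord0 ord0; pose v' : 'cV_n := \col_i v (lift ord0 i) ord0.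
have consD r (x : 'cV_n) : (cV_cons (r, x) + v = cV_cons (r + v0, x + v'))%R.
  apply/colP => i; rewrite mxE; case: (unliftP ord0 i) => [j ->|->].
    by rewrite !coordS_cons !mxE.
  by rewrite !coord0_cons.
have mfc : measurable_fun setT (fun p => f (cV_cons p)).
  by apply: measurableT_comp => //; exact: measurable_cV_cons.
under eq_integral => r _.
  under eq_integral do rewrite consD.
  rewrite (IH v' (fun x => f (cV_cons (r + v0, x)%R)))//; last first.
    apply: (measurableT_comp mfc); exact: measurable_pair1.
  over.
rewrite (integral_shift (f := fun r => \int[lebesgue_cV R n]_x f (cV_cons (r, x))))//.
  exact: (measurable_fun_fubini_tonelli_F (m2 := lebesgue_cV R n) _ mfc
    (fun p => f0 (cV_cons p))).
by move=> r; apply: integral_ge0.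
Qed.

End translation.

Section linear_change.
Variable R : realType.
Local Open Scope ereal_scope.

Definition unit_box n : set 'cV[R]_n :=
  [set x | forall i, `[0%R, 1%R]%classic (x i ord0)].

Lemma measurable_box n (A : 'I_n -> set R) : (forall i, measurable (A i)) ->
  measurable [set x : 'cV[R]_n | forall i, A i (x i ord0)].
Proof.
move=> mA; rewrite (_ : mkset _ = \bigcap_(i in [set: 'I_n]) (Defs.coord i @^-1` A i)).
  apply: fin_bigcap_measurable => // i _.
  by rewrite -[X in measurable X]setTI; exact: measurable_coord.
by apply/seteqP; split=> x /= H i; [move=> _; exact: H|exact: (H i)].
Qed.

Lemma measurable_unit_box n : measurable (@unit_box n).
Proof. exact: (@measurable_box n (fun=> `[0%R, 1%R]%classic)). Qed.

Lemma lebesgue_unit_box n : lebesgue_cV R n (@unit_box n) = 1.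
Proof.
rewrite (lebesgue_cV_box (A := fun=> `[0%R, 1%R]%classic))// big1// => i _.
by rewrite lebesgue_measure_itv/= lte_fin ltr01 oppr0 adde0.
Qed.

(** The preimage of a bounded set under an invertible matrix is bounded: the
    entries of x = A^-1 (A x) are at most the sum M of the |(A^-1)_ij|. *)
Lemma lebesgue_lin_unit_box_fin n (A : 'M[R]_n) : A \in unitmx ->
  lebesgue_cV R n [set x | @unit_box n (- (A *m x))%R] < +oo.
Proof.
move=> Au; pose M : R := (\sum_i \sum_j `|invmx A i j|)%R.
apply: (@le_lt_trans _ _ (lebesgue_cV R n
   [set x : 'cV[R]_n | forall i, `[(- M)%R, M]%classic (x i ord0)])).
  apply: le_measure; rewrite ?inE.
  - have -> : [set x | @unit_box n (- (A *m x))%R] =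
      (fun x : 'cV[R]_n => ((- A) *m x)%R) @^-1` @unit_box n.
      by apply/seteqP; split => x /=; rewrite mulNmx.
    rewrite -[X in _ X]setTI; apply: measurable_cV_mulmx => //.
    exact: measurable_unit_box.
  - exact: (@measurable_box n (fun=> `[(- M)%R, M]%classic)).
  - move=> x /= Ux i; rewrite in_itv/= -ler_norml.
    rewrite -[x](mulKmx Au) mxE (le_trans (ler_norm_sum _ _ _))//.
    apply: (@le_trans _ _ (\sum_j `|invmx A i j|)%R); last first.
      rewrite /M [leRHS](bigD1 i)//= lerDl.
      by apply: sumr_ge0 => ? _; apply: sumr_ge0.
    apply: ler_sum => j _; rewrite normrM ler_piMr//.
    by have := Ux j; rewrite /= in_itv/= mxE => /andP[? ?]; rewrite -normrN ger0_norm.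
rewrite (lebesgue_cV_box (A := fun=> `[(- M)%R, M]%classic))//.
rewrite (eq_bigr (fun=> (Num.max 0 (M + M))%R%:E)).
  by rewrite prodEFin ltry.
move=> i _; rewrite lebesgue_measure_itv/= lte_fin opprK -EFinD.
case: ltP => [NM|MN]; congr _%:E.
  by apply/esym/max_idPr; rewrite -lerBlDr sub0r ltW.
by apply/esym/max_idPl; rewrite -lerBrDr sub0r.
Qed.

(** The constant is the measure of - A^-1 Q, where Q is the unit box.  With h the
    indicator of Q, whose integral is 1, the integral of f (A x) equals the
    double integral of h y * f (A x + y), since A x + y = A (x + A^-1 y).
    Substituting y - A x for y moves the linear map onto h, and the inner
    integral of h (y - A x) over x is again independent of y. *)
Lemma integral_cV_mulmx n (A : 'M[R]_n) : A \in unitmx ->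
  exists C : R, forall f : 'cV[R]_n -> \bar R,
    measurable_fun setT f -> (forall x, 0 <= f x) ->
    \int[lebesgue_cV R n]_x f (A *m x) = C%:E * \int[lebesgue_cV R n]_x f x.
Proof.
move=> Au; set mu := lebesgue_cV R n.
pose h (y : 'cV[R]_n) : \bar R := (\1_(@unit_box n) y)%:E.
have h0 y : 0 <= h y by rewrite lee_fin.
have mQ : measurable (@unit_box n) by exact: measurable_unit_box.
have mh : measurable_fun setT h by apply/measurable_EFinP; exact: measurable_indic.
have inth : \int[mu]_y h y = 1 by rewrite integral_indic// setIT; exact: lebesgue_unit_box.
pose c := \int[mu]_x h (- (A *m x))%R.
have [C cC] : exists C : R, c = C%:E.
  exists (fine c); rewrite fineK// ge0_fin_numE; last exact: integral_ge0.
  have := lebesgue_lin_unit_box_fin Au; rewrite -/mu.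
  rewrite -[X in mu X]setIT -integral_indic//.
  rewrite (_ : [set x | _] = (fun x : 'cV[R]_n => ((- A) *m x)%R) @^-1` @unit_box n).
    rewrite -[X in _ X]setTI; apply: measurable_cV_mulmx => //.
  by apply/seteqP; split => x /=; rewrite mulNmx.
exists C => f mf f0; rewrite -cC.
have mAx : measurable_fun setT (fun x : 'cV[R]_n => A *m x).
  exact: measurable_cV_mulmx.
have mfA : measurable_fun setT (fun x : 'cV[R]_n => f (A *m x)).
  by apply: measurableT_comp.
have if0 : 0 <= \int[mu]_x f (A *m x) by apply: integral_ge0.
have mm1 : measurable_fun setT
    (fun p : 'cV[R]_n * 'cV[R]_n => h p.1 * f (A *m p.2 + p.1)%R).
  apply: emeasurable_funM; first exact: measurableT_comp.
  apply: (measurableT_comp mf); apply: measurable_cV_add => //.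
  exact: measurable_cV_mulmx.
have mhA (y : 'cV[R]_n) : measurable_fun setT (fun x : 'cV[R]_n => h (y - A *m x)%R).
  apply: (measurableT_comp mh).
  under eq_fun do rewrite -mulNmx; apply: measurable_cV_add => //.
  exact: measurable_cV_mulmx.
have mm2 : measurable_fun setT
    (fun p : 'cV[R]_n * 'cV[R]_n => h (p.1 - A *m p.2)%R * f p.1).
  apply: emeasurable_funM; last exact: measurableT_comp.
  apply: (measurableT_comp mh).
  rewrite (_ : (fun _ => _) = fun p : 'cV[R]_n * 'cV[R]_n => (p.1 + (- A) *m p.2)%R).
    by apply: measurable_cV_add => //; exact: measurable_cV_mulmx.
  by apply/funext => p; rewrite mulNmx.
transitivity (\int[mu]_y \int[mu]_x (h y * f (A *m x + y)%R)).
  rewrite -[LHS]mul1e -inth -ge0_integralZr//.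
  apply: eq_integral => y _; rewrite ge0_integralZl//; last first.
    by apply: (measurableT_comp mf); exact: measurable_cV_add.
  congr (_ * _).
  rewrite -(integral_cV_shift (invmx A *m y) mfA)//.
  by apply: eq_integral => x _; rewrite mulmxDr mulKVmx.
rewrite (fubini_tonelli (fun p : 'cV[R]_n * 'cV[R]_n =>
  h p.1 * f (A *m p.2 + p.1)%R))//; last by move=> p; exact: mule_ge0.
transitivity (\int[mu]_x \int[mu]_y (h (y - A *m x)%R * f y)).
  apply: eq_integral => x _.
  rewrite -(@integral_cV_shift R n (A *m x) (fun y => h (y - A *m x)%R * f y)).
  - by apply: eq_integral => y _; rewrite addrK addrC.
  - exact: (measurableT_comp mm2 (measurable_pair2 x)).
  - by move=> y; exact: mule_ge0.
rewrite -(fubini_tonelli (fun p : 'cV[R]_n * 'cV[R]_n =>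
  h (p.1 - A *m p.2)%R * f p.1))//; last by move=> p; exact: mule_ge0.
rewrite -ge0_integralZl//; last exact: integral_ge0.
apply: eq_integral => y _ /=; rewrite ge0_integralZr//.
congr (_ * _); rewrite /c.
rewrite -(@integral_cV_shift R n (- (invmx A *m y)) (fun x => h (- (A *m x))%R))//; last first.
  by have := mhA 0%R; under eq_fun do rewrite sub0r.
apply: eq_integral => x _; congr h.
by rewrite mulmxDr mulmxN mulKVmx// opprD opprK addrC.
Qed.

End linear_change.

(** * The inner product of L^2 *)

Section complex_integral.
Local Open Scope complex_scope.
Variables (R : realType) (n : nat).
Local Notation mu := (lebesgue_cV R n).
Local Notation fn := ('cV[R]_n -> R[i]).
Implicit Types (F H f h : fn) (c : R[i]).

Definition cmeasurable F :=
  measurable_fun setT (fun x => complex.Re (F x)) /\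
  measurable_fun setT (fun x => complex.Im (F x)).

Definition cintegrable F :=
  mu.-integrable setT (fun x => (complex.Re (F x))%:E) /\
  mu.-integrable setT (fun x => (complex.Im (F x))%:E).

Definition cintegral F : R[i] :=
  Rintegral mu setT (fun x => complex.Re (F x)) +i*
  Rintegral mu setT (fun x => complex.Im (F x)).

Lemma ReD (z w : R[i]) : complex.Re (z + w) = complex.Re z + complex.Re w.
Proof. by case: z; case: w. Qed.

Lemma ImD (z w : R[i]) : complex.Im (z + w) = complex.Im z + complex.Im w.
Proof. by case: z; case: w. Qed.

Lemma ReM (z w : R[i]) : complex.Re (z * w) =
  complex.Re z * complex.Re w - complex.Im z * complex.Im w.
Proof. by case: z; case: w. Qed.

Lemma ImM (z w : R[i]) : complex.Im (z * w) =
  complex.Re z * complex.Im w + complex.Im z * complex.Re w.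
Proof. by case: z; case: w. Qed.

Lemma ReJ (z : R[i]) : complex.Re z^* = complex.Re z.
Proof. by case: z. Qed.

Lemma ImJ (z : R[i]) : complex.Im z^* = - complex.Im z.
Proof. by case: z. Qed.

Lemma cmeasurable_lin c f h : cmeasurable f -> cmeasurable h ->
  cmeasurable (fun x => c * f x + h x).
Proof.
move=> [rf jf] [rh jh]; split.
  under eq_fun do rewrite ReD ReM.
  apply: measurable_funD => //; apply: measurable_funB;
    by apply: measurable_funM.
under eq_fun do rewrite ImD ImM.
apply: measurable_funD => //; apply: measurable_funD;
  by apply: measurable_funM.
Qed.

Lemma cmeasurable_mulJ f h : cmeasurable f -> cmeasurable h ->
  cmeasurable (fun x => f x * (h x)^*).
Proof.
move=> [rf jf] [rh jh]; split.
  under eq_fun do rewrite ReM ReJ ImJ mulrN opprK.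
  by apply: measurable_funD; apply: measurable_funM.
under eq_fun do rewrite ImM ReJ ImJ mulrN addrC.
by apply: measurable_funB; apply: measurable_funM.
Qed.

Lemma cintegral_lin c F H : cintegrable F -> cintegrable H ->
  cintegral (fun x => c * F x + H x) = c * cintegral F + cintegral H.
Proof.
case: c => a b [rF jF] [rH jH].
have Zl u (k : 'cV[R]_n -> R) : mu.-integrable setT (fun x => (k x)%:E) ->
    mu.-integrable setT (fun x => (u * k x)%:E).
  by move=> ik; under eq_fun do rewrite EFinM; exact: integrableZl.
have addi (k l : 'cV[R]_n -> R) : mu.-integrable setT (fun x => (k x)%:E) ->
    mu.-integrable setT (fun x => (l x)%:E) ->
    mu.-integrable setT (fun x => (k x + l x)%:E).
  by move=> ik il; under eq_fun do rewrite EFinD; exact: integrableD.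
have subi (k l : 'cV[R]_n -> R) : mu.-integrable setT (fun x => (k x)%:E) ->
    mu.-integrable setT (fun x => (l x)%:E) ->
    mu.-integrable setT (fun x => (k x - l x)%:E).
  by move=> ik il; under eq_fun do rewrite EFinB; exact: integrableB.
rewrite /cintegral; apply/eqP; rewrite eq_complex /= -!/(complex.Re _) -!/(complex.Im _).
apply/andP; split; apply/eqP.
  under eq_Rintegral do rewrite ReD ReM /=.
  rewrite RintegralD//; [|apply: subi; exact: Zl].
  by rewrite RintegralB//; [|exact: Zl|exact: Zl]; rewrite !RintegralZl.
under eq_Rintegral do rewrite ImD ImM /=.
rewrite RintegralD//; [|apply: addi; exact: Zl].
by rewrite RintegralD//; [|exact: Zl|exact: Zl]; rewrite !RintegralZl.
Qed.

Lemma cintegralJ F : cintegrable F ->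
  cintegral (fun x => (F x)^*) = (cintegral F)^*.
Proof.
move=> [rF jF]; rewrite /cintegral /=; congr (_ +i* _).
  by under eq_Rintegral do rewrite ReJ.
under eq_Rintegral do rewrite ImJ -mulN1r.
by rewrite RintegralZl// mulN1r.
Qed.

Lemma L2normsq_ge0 f : (0 <= L2normsq f)%E.
Proof. by apply: integral_ge0 => x _; rewrite lee_fin addr_ge0// sqr_ge0. Qed.

Lemma L2_cmeasurable f : @L2 R n f -> cmeasurable f.
Proof. by case. Qed.

Lemma cmeasurable_sqnorm f : cmeasurable f ->
  measurable_fun setT (fun x => (complex.Re (f x) ^+ 2 + complex.Im (f x) ^+ 2)%:E).
Proof.
move=> [rf jf]; apply/measurable_EFinP.
by apply: measurable_funD; exact: measurable_funX.
Qed.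

Lemma L2_integrable f : @L2 R n f ->
  mu.-integrable setT (fun x => (complex.Re (f x) ^+ 2 + complex.Im (f x) ^+ 2)%:E).
Proof.
move=> f2; apply/integrableP; split.
  by apply: cmeasurable_sqnorm; exact: L2_cmeasurable.
case: f2 => _ _; apply: le_lt_trans; rewrite /L2normsq.
rewrite (eq_integral (fun x => (complex.Re (f x) ^+ 2 + complex.Im (f x) ^+ 2)%:E))//.
by move=> x _; rewrite gee0_abs// lee_fin addr_ge0// sqr_ge0.
Qed.

Lemma L2_dot_integrable f h : @L2 R n f -> @L2 R n h ->
  cintegrable (fun x => f x * (h x)^*).
Proof.
move=> f2 h2; have [mr mi] := cmeasurable_mulJ (L2_cmeasurable f2) (L2_cmeasurable h2).
have := integrableD measurableT (L2_integrable f2) (L2_integrable h2).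
(* Both parts of z w^* are bounded by |z|^2 + |w|^2. *)
move=> iq; split; apply: (le_integrable _ _ _ iq) => //;
  try (exact/measurable_EFinP); move=> x _; rewrite /= lee_fin ?(ReM, ImM) ReJ ImJ;
  move: (complex.Re (f x)) (complex.Im (f x)) (complex.Re (h x)) (complex.Im (h x));
  move=> a b u v; rewrite [leRHS]ger0_norm ?addr_ge0 ?sqr_ge0// ler_norml;
  have := sqr_ge0 (a + u); have := sqr_ge0 (a - u);
  have := sqr_ge0 (b + v); have := sqr_ge0 (b - v);
  have := sqr_ge0 (a + v); have := sqr_ge0 (a - v);
  have := sqr_ge0 (b + u); have := sqr_ge0 (b - u);
  have := sqr_ge0 a; have := sqr_ge0 b; have := sqr_ge0 u; have := sqr_ge0 v;
  nra.
Qed.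

Lemma L2_lin c f h : @L2 R n f -> @L2 R n h -> @L2 R n (fun x => c * f x + h x).
Proof.
move=> f2 h2.
have [mr mi] := cmeasurable_lin c (L2_cmeasurable f2) (L2_cmeasurable h2).
split => //; case: c mr mi => a b mr mi.
set K := 2 * (a ^+ 2 + b ^+ 2).
have K0 : 0 <= K by rewrite mulr_ge0 ?addr_ge0 ?sqr_ge0.
(* |c z + w|^2 <= 2 |c|^2 |z|^2 + 2 |w|^2. *)
apply: (@le_lt_trans _ _ (\int[mu]_x
  (K%:E * (complex.Re (f x) ^+ 2 + complex.Im (f x) ^+ 2)%:E +
   2%:E * (complex.Re (h x) ^+ 2 + complex.Im (h x) ^+ 2)%:E))%E).
  apply: ge0_le_integral => //.
  - by move=> x _; rewrite lee_fin addr_ge0// sqr_ge0.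
  - exact: (@cmeasurable_sqnorm (fun x => (a +i* b) * f x + h x)).
  - by apply: emeasurable_funD; apply: measurable_funeM;
      apply: cmeasurable_sqnorm; exact: L2_cmeasurable.
  - move=> x _; rewrite -!EFinM -EFinD lee_fin ReD ReM ImD ImM /= /K.
    move: (complex.Re (f x)) (complex.Im (f x)) (complex.Re (h x)) (complex.Im (h x)).
    move=> u v p q.
    have := sqr_ge0 (a * u - b * v - p); have := sqr_ge0 (a * v + b * u - q).
    by nra.
have i1 := integrableZl measurableT K (L2_integrable f2).
have i2 := integrableZl measurableT 2 (L2_integrable h2).
have /integrableP[_] := integrableD measurableT i1 i2.
apply: le_lt_trans; rewrite le_eqVlt; apply/orP; left; apply/eqP.
apply: eq_integral => x _; rewrite gee0_abs//=.
by rewrite -!EFinM -EFinD lee_fin addr_ge0 ?mulr_ge0 ?addr_ge0 ?sqr_ge0.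
Qed.

End complex_integral.

Section inner_product.
Local Open Scope complex_scope.
Variables (R : realType) (n : nat).
Local Notation mu := (lebesgue_cV R n).
Local Notation fn := ('cV[R]_n -> R[i]).
Implicit Types (f g h : fn) (c : R[i]).

Lemma L2_0 : @L2 R n (fun=> 0).
Proof.
split => //=; rewrite /L2normsq /= integral0_eq ?ltry// => x _.
by rewrite expr0n /= addr0.
Qed.

Lemma L2dot_lin c f g h : @L2 R n f -> @L2 R n g -> @L2 R n h ->
  L2dot (fun x => c * f x + g x) h = c * L2dot f h + L2dot g h.
Proof.
move=> f2 g2 h2; rewrite -[RHS](@cintegral_lin _ _ c); last 2 first.
- exact: L2_dot_integrable.
- exact: L2_dot_integrable.
by congr cintegral; apply/funext => x; rewrite mulrDl mulrA.
Qed.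

Lemma L2dotJ f h : @L2 R n f -> @L2 R n h -> L2dot h f = (L2dot f h)^*.
Proof.
move=> f2 h2; rewrite -[RHS]cintegralJ; last exact: L2_dot_integrable.
by congr cintegral; apply/funext => x; rewrite rmorphM /= conjcK mulrC.
Qed.

Lemma L2normsq_dot f : @L2 R n f -> L2normsq f = (complex.Re (L2dot f f))%:E.
Proof.
move=> f2; rewrite /L2dot /Rintegral /= fineK.
  by apply: eq_integral => x _; rewrite ReM ReJ ImJ mulrN opprK !expr2.
under eq_integral do rewrite ReM ReJ ImJ mulrN opprK -!expr2.
by rewrite ge0_fin_numE; [case: f2|exact: L2normsq_ge0].
Qed.

Lemma L2_sum (I : Type) (s : seq I) (b : I -> R[i]) (u : I -> fn) :
  (forall i, @L2 R n (u i)) -> @L2 R n (fun x => \sum_(i <- s) b i * u i x).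
Proof.
move=> u2; elim: s => [|i s IH].
  by under eq_fun do rewrite big_nil; exact: L2_0.
by under eq_fun do rewrite big_cons; exact: L2_lin.
Qed.

Lemma L2_sub_sum (I : Type) (s : seq I) (b : I -> R[i]) (u : I -> fn) f :
  (forall i, @L2 R n (u i)) -> @L2 R n f ->
  @L2 R n (fun x => f x - \sum_(i <- s) b i * u i x).
Proof.
move=> u2 f2; under eq_fun do rewrite addrC -mulN1r.
by apply: L2_lin => //; exact: L2_sum.
Qed.

Lemma L2dot_suml (I : Type) (s : seq I) (b : I -> R[i]) (u : I -> fn) h :
  (forall i, @L2 R n (u i)) -> @L2 R n h ->
  L2dot (fun x => \sum_(i <- s) b i * u i x) h = \sum_(i <- s) b i * L2dot (u i) h.
Proof.
move=> u2 h2; elim: s => [|i s IH].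
  under eq_fun do rewrite big_nil.
  have := L2dot_lin (-1) L2_0 L2_0 h2; under eq_fun do rewrite mulr0 addr0.
  by rewrite big_nil mulN1r addNr.
under eq_fun do rewrite big_cons.
by rewrite L2dot_lin// ?big_cons ?IH//; exact: L2_sum.
Qed.

Lemma L2dot_sumr (I : Type) (s : seq I) (b : I -> R[i]) (u : I -> fn) h :
  (forall i, @L2 R n (u i)) -> @L2 R n h ->
  L2dot h (fun x => \sum_(i <- s) b i * u i x) = \sum_(i <- s) (b i)^* * L2dot h (u i).
Proof.
move=> u2 h2; rewrite L2dotJ//; last exact: L2_sum.
rewrite L2dot_suml// rmorph_sum; apply: eq_bigr => i _.
by rewrite rmorphM /= [in RHS]L2dotJ.
Qed.

(** Completing the square: the squared distance from f to a finite combination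
    of orthonormal vectors is smallest when the coefficients are the Fourier
    coefficients of f. *)
Lemma L2dot_sub_sum (I : eqType) (s : seq I) (b : I -> R[i]) (u : I -> fn) f :
  uniq s -> (forall i, @L2 R n (u i)) -> @L2 R n f ->
  {in s &, forall i j, L2dot (u i) (u j) = (i == j)%:R} ->
  let r x := f x - \sum_(i <- s) b i * u i x in
  L2dot r r = L2dot f f - \sum_(i <- s) L2dot f (u i) * (L2dot f (u i))^*
    + \sum_(i <- s) (b i - L2dot f (u i)) * (b i - L2dot f (u i))^*.
Proof.
move=> us u2 f2 on r.
pose w : fn := fun x => \sum_(i <- s) b i * u i x.
have w2 : @L2 R n w by exact: L2_sum.
have rE : r = fun x => -1 * w x + f x.
  by apply/funext => x; rewrite mulN1r addrC.
have r2 : @L2 R n r by exact: L2_sub_sum.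
have -> : L2dot r r = - L2dot w r + L2dot f r.
  by rewrite {1}rE L2dot_lin// mulN1r.
have dr h : @L2 R n h -> L2dot h r = L2dot h f - L2dot h w.
  move=> h2; rewrite [LHS]L2dotJ// [L2dot h f]L2dotJ// [L2dot h w]L2dotJ//.
  by rewrite rE L2dot_lin// mulN1r rmorphD rmorphN addrC.
rewrite !dr// [L2dot f w]L2dot_sumr// [L2dot w f]L2dot_suml//.
have -> : L2dot w w = \sum_(i <- s) b i * (b i)^*.
  rewrite {1}/w L2dot_suml// big_seq [RHS]big_seq.
  apply: eq_bigr => i si; congr (_ * _); rewrite L2dot_sumr//.
  rewrite (bigD1_seq i)//= on// eqxx mulr1 big_seq_cond big1 ?addr0// => j.
  by move=> /andP[sj ji]; rewrite on// eq_sym (negbTE ji) mulr0.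
have -> : \sum_(i <- s) b i * L2dot (u i) f = \sum_(i <- s) b i * (L2dot f (u i))^*.
  by apply: eq_bigr => i _; rewrite L2dotJ.
rewrite opprB [LHS]addrC -!addrA; congr (_ + _).
rewrite -!sumrN -!big_split/=; apply: eq_bigr => i _.
rewrite rmorphB /=; ring.
Qed.

Lemma best_approx (I : eqType) (s : seq I) (b : I -> R[i]) (u : I -> fn) f :
  uniq s -> (forall i, @L2 R n (u i)) -> @L2 R n f ->
  {in s &, forall i j, L2dot (u i) (u j) = (i == j)%:R} ->
  (L2normsq (fun x => (f x - \sum_(i <- s) L2dot f (u i) * u i x)%R) <=
   L2normsq (fun x => (f x - \sum_(i <- s) b i * u i x)%R))%E.
Proof.
move=> us u2 f2 on.
have r2 (v : I -> R[i]) := L2_sub_sum s v u2 f2.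
rewrite !L2normsq_dot// lee_fin !L2dot_sub_sum//.
rewrite [X in _ + X](_ : _ = 0); last first.
  by apply: big1 => i _; rewrite subrr mul0r.
rewrite addr0 [leRHS]ReD lerDl.
have : 0 <= \sum_(i <- s) (b i - L2dot f (u i)) * (b i - L2dot f (u i))^*.
  by apply: sumr_ge0 => i _; exact: mulcJ_ge0.
by rewrite lecE => /andP[].
Qed.

End inner_product.

(** * Orthonormal expansions *)

(** An approximation of f in the span uses finitely many vectors.  For any
    finite family containing those, the Fourier sum of f is at least as close to
    f, so the convergence is unconditional. *)
Lemma fourier_expansion (R : realType) (n : nat) (I : eqType) (D : set I)
    (u : I -> 'cV[R]_n -> R[i]) (f : 'cV[R]_n -> R[i]) :
  (forall i, @L2 R n (u i)) ->
  (forall i j, D i -> D j -> L2dot (u i) (u j) = (i == j)%:R) ->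
  L2closure (lin_span (u @` D)) f ->
  forall e : R, 0 < e -> exists2 s0 : seq I, {in s0, forall i, D i} &
    forall s, uniq s -> {in s, forall i, D i} -> {subset s0 <= s} ->
    (L2normsq (fun x => (f x - \sum_(i <- s) L2dot f (u i) * u i x)%R)
      < (e ^+ 2)%:E)%E.
Proof.
move=> u2 on [f2 cl] e e0; have [_ [m [b [v [vD ->]]]] lt_e] := cl e e0.
have /choice[p Dp] : forall l, exists i, D i /\ u i = v l.
  by move=> l; have [i Di <-] := vD l; exists i.
exists [seq p l | l <- index_enum 'I_m] => [_ /mapP[l _ ->]|s us sD s0s].
  by have [] := Dp l.
apply: le_lt_trans lt_e.
have -> : (fun x => f x - \sum_(l < m) b l * v l x) =
    (fun x => f x - \sum_(i <- s) (\sum_(l < m | p l == i) b l) * u i x).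
  apply/funext => x; congr (_ - _).
  under [RHS]eq_bigr do rewrite mulr_suml big_mkcond /=.
  rewrite exchange_big /=; apply: eq_bigr => l _.
  have ps : p l \in s by apply: s0s; rewrite map_f ?mem_index_enum.
  rewrite (bigD1_seq (p l))//= eqxx (proj2 (Dp l)) big1 ?addr0// => i.
  by rewrite eq_sym => /negbTE ->.
apply: best_approx => // i j si sj; apply: on; exact: sD.
Qed.

(** * Affine maps acting on L^2 *)

Section affine_L2.
Variables (R : realType) (n : nat).
Local Notation fn := ('cV[R]_n -> R[i]).

(** A strictly positive C lets a tolerance be divided by its square root; this is
    why C is a bound, |C0| + 1, rather than the exact factor C0 of
    integral_cV_mulmx, which comes without a sign. *)
Lemma L2normsq_aff (s : aff R n) : s.1 \in unitmx ->
  exists2 C : R, 0 < C & forall f : fn, cmeasurable f ->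
    (L2normsq (fun x => f (aff_act s x)) <= C%:E * L2normsq f)%E.
Proof.
move=> su; have [C HC] := integral_cV_mulmx su.
exists (`|C| + 1) => [|f mf]; first by rewrite ltr_pwDr.
pose q (x : 'cV[R]_n) := (complex.Re (f x) ^+ 2 + complex.Im (f x) ^+ 2)%:E.
have q0 x : (0 <= q x)%E by rewrite lee_fin addr_ge0// sqr_ge0.
have mq : measurable_fun setT q by exact: cmeasurable_sqnorm.
rewrite [leLHS](_ : _ = \int[lebesgue_cV R n]_x q (s.1 *m x + s.2)%R)%E//.
rewrite (HC (fun x => q (x + s.2)%R))//; last first.
  by apply: (measurableT_comp mq); exact: measurable_cV_add.
rewrite integral_cV_shift//; apply: lee_wpmul2r; first exact: L2normsq_ge0.
by rewrite lee_fin (le_trans (ler_norm _))// lerDl.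
Qed.

Lemma cmeasurable_aff (s : aff R n) (f : fn) :
  cmeasurable f -> cmeasurable (fun x => f (aff_act s x)).
Proof.
have ms := measurable_aff_act s.
by move=> [rf jf]; split; [exact: (measurableT_comp rf ms)|
  exact: (measurableT_comp jf ms)].
Qed.

Lemma L2_aff (s : aff R n) (f : fn) : s.1 \in unitmx ->
  @L2 R n f -> @L2 R n (fun x => f (aff_act s x)).
Proof.
move=> su f2; have [C C0 HC] := L2normsq_aff su.
have [mr mi] := cmeasurable_aff s (L2_cmeasurable f2).
split => //; apply: le_lt_trans (HC _ (L2_cmeasurable f2)) _.
by rewrite lte_mul_pinfty// ?lee_fin ?ltW//; case: f2.
Qed.

End affine_L2.

(** * Splitting crystal groups *)

Section affine_maps.
Variables (R : realType) (n : nat).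
Implicit Types (s t : aff R n) (A : 'M[R]_n) (k x : 'cV[R]_n).

(** Polarization of the identity |A x|^2 = |x|^2, evaluated at basis vectors. *)
Lemma isometry_orthogonal s : is_isometry s -> s.1^T *m s.1 = 1%:M.
Proof.
move=> iso; pose Q (x : 'cV[R]_n) := \sum_i x i ord0 ^+ 2.
pose B (x y : 'cV[R]_n) := \sum_i x i ord0 * y i ord0.
have Q0 x : 0 <= Q x by apply: sumr_ge0 => i _; exact: sqr_ge0.
have Qs x : Q (s.1 *m x) = Q x.
  have := iso x 0; rewrite /aff_act mulmx0 add0r addrK subr0.
  move/(congr1 (fun z : R => z ^+ 2)); rewrite /euclid_norm.
  by rewrite !sqr_sqrtr//; exact: Q0.
have QD x y : Q (x + y) = Q x + Q y + B x y *+ 2.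
  rewrite /Q /B -sumrMnl -!big_split/=; apply: eq_bigr => i _.
  by rewrite mxE sqrrD addrAC.
have Bs x y : B (s.1 *m x) (s.1 *m y) = B x y.
  have := QD (s.1 *m x) (s.1 *m y); rewrite -mulmxDr !Qs QD => /addrI/eqP.
  by rewrite eqrMn2r => /eqP.
apply/matrixP => i j; rewrite !mxE.
have := Bs (delta_mx i ord0) (delta_mx j ord0); rewrite /B.
under eq_bigr do rewrite -!colE !mxE.
under [X in _ = X -> _]eq_bigr do rewrite !mxE.
move=> E; under eq_bigr do rewrite mxE.
rewrite E (bigD1 i)//= !eqxx mul1r big1 ?addr0; first by rewrite andbT.
by move=> k /negbTE ->; rewrite mul0r.
Qed.

Lemma isometry_unitmx s : is_isometry s -> s.1 \in unitmx.
Proof. by move=> /isometry_orthogonal/mulmx1_unit[]. Qed.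

Lemma isometry_det s : is_isometry s -> `|\det s.1| = 1.
Proof.
move=> /isometry_orthogonal/(congr1 determinant).
rewrite det_mulmx det_tr det1 -expr2 => /eqP.
by rewrite sqrf_eq1 => /orP[]/eqP ->; rewrite ?normrN normr1.
Qed.

(** An isometry has determinant of modulus 1, so D has no scalar factor. *)
Lemma Dop_rotation s k (f : 'cV[R]_n -> R[i]) : is_isometry s ->
  Dop (s.1, k) f = Dop (1%:M, k) (fun x => f (invmx s.1 *m x)).
Proof.
move=> iso; apply/funext => x; rewrite /Dop /aff_act /aff_inv /=.
by rewrite (isometry_det iso) det1 normr1 invmx1 !mul1mx mulmxBr.
Qed.

Lemma Dop_translation k (f : 'cV[R]_n -> R[i]) :
  Dop (1%:M, k) f = fun x => f (x - k).
Proof.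
apply/funext => x; rewrite /Dop /aff_act /aff_inv /=.
by rewrite det1 normr1 sqrtr1 invr1 invmx1 !mul1mx mul1r.
Qed.

End affine_maps.

Section splitting.
Variables (R : realType) (n r : nat).
Variables (Gam : set (aff R n)) (G : set 'M[R]_n) (Lam : set 'cV[R]_n).
Variables (g : 'I_r.+1 -> 'M[R]_n).
Hypothesis hGam : splitting_crystal_triple Gam G Lam.
Hypotheses (g_inj : injective g) (g_range : range g = G).
Implicit Types (i j : 'I_r.+1) (k : 'cV[R]_n) (s : aff R n).

Lemma Gam_isometry s : Gam s -> is_isometry s.
Proof. by case: hGam => -[] [+ _ _ _ _ _] _ _ _ => /[apply]. Qed.

Lemma Lam_mem k : Lam k <-> Gam (1%:M, k).
Proof. by case: hGam => -[] _ -> _ _. Qed.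

Lemma GamP s : Gam s <-> exists i k, Lam k /\ s = (g i, g i *m k).
Proof.
case: hGam => _ ->; rewrite -g_range; split=> [[_ [k [[i _ <-] Lk ->]]]|[i [k [Lk ->]]]].
  by exists i, k.
by exists (g i), k; split => //; exists i.
Qed.

Lemma Lam0 : Lam 0.
Proof. by apply/Lam_mem; case: hGam => -[] []. Qed.

Lemma Gam_point i : Gam (g i, 0).
Proof. by apply/GamP; exists i, 0; split; [exact: Lam0|rewrite mulmx0]. Qed.

Lemma g_isometry i : is_isometry (g i, 0).
Proof. exact/Gam_isometry/Gam_point. Qed.

Lemma g_unit i : g i \in unitmx.
Proof. exact: (isometry_unitmx (g_isometry i)). Qed.

Lemma lin_in_range s : Gam s -> exists i, g i = s.1.
Proof. by move=> /GamP[i [k [_ ->]]]; exists i. Qed.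

Lemma Gam_mul s t : Gam s -> Gam t -> Gam (aff_mul s t).
Proof. by case: hGam => -[] [_ _ + _ _ _] _ _ _; apply. Qed.

Lemma Gam_inv s : Gam s -> Gam (aff_inv s).
Proof. by case: hGam => -[] [_ _ _ + _ _] _ _ _; apply. Qed.

(** Conjugating the translation by k with g_i gives the translation by g_i k. *)
Lemma Lam_rot i k : Lam k -> Lam (g i *m k).
Proof.
move=> Lk; apply/Lam_mem.
have Gik : Gam (g i, g i *m k) by apply/GamP; exists i, k.
have := Gam_mul Gik (Gam_inv (Gam_point i)).
by rewrite /aff_mul /aff_inv/= mulmx0 oppr0 mulmx0 add0r mulmxV// g_unit.
Qed.

Lemma Lam_rotV i k : Lam k -> Lam (invmx (g i) *m k).
Proof.
move=> Lk; have [j gj] := lin_in_range (Gam_inv (Gam_point i)).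
by move: gj => /= <-; exact: Lam_rot.
Qed.

Lemma point_group_perm i : exists rho : {perm 'I_r.+1},
  forall j, g (rho j) = invmx (g i) *m g j.
Proof.
have /choice[rho rhoE] : forall j, exists l, g l = invmx (g i) *m g j.
  move=> j; have := Gam_mul (Gam_inv (Gam_point i)) (Gam_point j).
  by move=> /lin_in_range.
have rho_inj : injective rho.
  move=> j l /(congr1 g); rewrite !rhoE => /(congr1 (mulmx (g i))).
  by rewrite !mulKVmx ?g_unit// => /g_inj.
by exists (perm rho_inj) => j; rewrite permE.
Qed.

Variable phi : 'cV[R]_n -> R[i].
Local Notation Phi := (rotated g phi).

Lemma Dop_Gam i k : Dop (g i, g i *m k) phi = Dop (1%:M, g i *m k) (Phi i).
Proof. exact: (Dop_rotation _ _ (g_isometry i)). Qed.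

Lemma Dop_Lam i k : Dop (1%:M, k) (Phi i) = Dop (g i, g i *m (invmx (g i) *m k)) phi.
Proof. by rewrite Dop_Gam mulKVmx// g_unit. Qed.

Lemma Gam_of_Lam i k : Lam k -> Gam (g i, g i *m (invmx (g i) *m k)).
Proof. by move=> Lk; apply/GamP; exists i, (invmx (g i) *m k); split=> //; exact: Lam_rotV. Qed.

Lemma orbit_family_rotated :
  orbit_family Gam (fun _ : 'I_1 => phi) = orbit_family (translations Lam) Phi.
Proof.
apply/seteqP; split=> f.
  move=> [_ [s [/GamP[i [k [Lk ->]]] ->]]]; exists i, (1%:M, g i *m k); split.
    by exists (g i *m k) => //; exact: Lam_rot.
  exact: Dop_Gam.
move=> [i [_ [[k Lk <-] ->]]]; exists ord0, (g i, g i *m (invmx (g i) *m k)).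
by split; [exact: Gam_of_Lam|exact: Dop_Lam].
Qed.

Lemma orbit_family1 :
  orbit_family Gam (fun _ : 'I_1 => phi) = [set Dop s phi | s in Gam].
Proof.
apply/seteqP; split=> f; first by move=> [_ [s [Gs ->]]]; exists s.
by move=> [s Gs <-]; exists ord0, s.
Qed.

(** The pair (i, k) in the Lambda-orbit corresponds to (g_i, k) in Gamma, and this
    is a bijection because g is injective. *)
Lemma orthonormal_orbit_rotated :
  orthonormal_orbit Gam (fun _ : 'I_1 => phi) <->
  orthonormal_orbit (translations Lam) Phi.
Proof.
have gE i j k l : ((g i, k) == (g j, l) :> aff R n) =
    (i == j) && ((1%:M, k) == (1%:M, l) :> aff R n).
  by rewrite !xpair_eqE eqxx (inj_eq g_inj).
split=> on.
  move=> i j _ _ [k Lk <-] [l Ll <-].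
  rewrite !Dop_Lam (on ord0 ord0)//; [|exact: Gam_of_Lam..].
  by rewrite eqxx gE !mulKVmx ?g_unit.
move=> i j _ _ /GamP[p [k [Lk ->]]] /GamP[q [l [Ll ->]]].
rewrite !Dop_Gam on; [|by exists (g p *m k) => //; exact: Lam_rot
                      |by exists (g q *m l) => //; exact: Lam_rot].
by rewrite gE (ord1 i) (ord1 j) eqxx.
Qed.

End splitting.

(** * Refinement equations *)

Lemma sqr_div_sqrt (R : rcfType) (e C : R) : 0 < C -> C * (e / Num.sqrt C) ^+ 2 = e ^+ 2.
Proof.
move=> C0; rewrite expr_div_n sqr_sqrtr ?ltW// mulrC mulfVK//.
exact: lt0r_neq0.
Qed.

Section refinement.
Variables (R : realType) (n r : nat).
Local Notation fn := ('cV[R]_n -> R[i]).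
Variables (Lam : set 'cV[R]_n) (a : 'M[R]_n) (Phi : 'I_r -> fn).

(** One scalar equation of the system Phi (x) = sum_k c_k Phi (a x - k): the rows
    are produced and transformed one at a time. *)
Definition row_refinement (f : fn) (c : 'cV[R]_n -> 'I_r -> R[i]) : Prop :=
  forall e : R, 0 < e ->
    exists F0 : {fset 'cV[R]_n}, [set` F0] `<=` Lam /\
    forall F : {fset 'cV[R]_n}, [set` F] `<=` Lam -> (F0 `<=` F)%fset ->
      (L2normsq (fun x => f x -
         \sum_(k <- F) \sum_j c k j * Phi j (a *m x - k))%R < (e ^+ 2)%:E)%E.

Definition translates (p : 'cV[R]_n * 'I_r) : fn := fun x => Phi p.2 (x - p.1).

Lemma orbit_translates :
  orbit_family (translations Lam) Phi = translates @` [set p | Lam p.1].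
Proof.
apply/seteqP; split=> f.
  by move=> [j [_ [[k Lk <-] ->]]]; exists (k, j) => //; rewrite Dop_translation.
move=> [[k j] /= Lk <-]; exists j, (1%:M, k); split; first by exists k.
by rewrite Dop_translation.
Qed.

Hypothesis Phi2 : forall j, @L2 R n (Phi j).

Lemma L2_translates p : @L2 R n (translates p).
Proof.
have := L2_aff (s := (1%:M, - p.1)) (unitmx1 _ _) (Phi2 p.2).
by rewrite /aff_act /=; under eq_fun do rewrite mul1mx.
Qed.

Lemma row_sumE (F : {fset 'cV[R]_n}) (c : 'cV[R]_n -> 'I_r -> R[i]) x :
  \sum_(k <- F) \sum_j c k j * Phi j (x - k) =
  \sum_(p <- [seq (k, j) | k <- F, j <- index_enum 'I_r]) c p.1 p.2 * translates p x.
Proof. by rewrite big_allpairs. Qed.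

(** Substituting a x in the Fourier expansion of f; the tolerance is divided by
    the square root of the factor by which this substitution may increase
    squared norms. *)
Lemma row_refinement_expansion (f : fn) : a \in unitmx ->
  orthonormal_orbit (translations Lam) Phi ->
  L2closure (lin_span (orbit_family (translations Lam) Phi)) f ->
  row_refinement (fun x => f (a *m x)) (fun k j => L2dot f (translates (k, j))).
Proof.
move=> au on fV e e0.
have [C C0 HC] := L2normsq_aff (s := (a, 0)) au.
have e'0 : 0 < e / Num.sqrt C by rewrite divr_gt0// sqrtr_gt0.
have on' p q : Lam p.1 -> Lam q.1 ->
    L2dot (translates p) (translates q) = (p == q)%:R.
  case: p q => [k i] [l j] /= Lk Ll.
  have := on i j (1%:M, k) (1%:M, l).
  rewrite !Dop_translation => -> //; [|by exists k|by exists l].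
  by rewrite !xpair_eqE eqxx /= andbC.
have f2 : @L2 R n f by case: fV.
rewrite orbit_translates in fV.
have [s0 s0L Hs0] := fourier_expansion L2_translates on' fV e'0.
exists [fset p.1 | p in s0]%fset; split.
  by move=> _ /= /imfsetP[p /= ps ->]; exact: s0L.
move=> F FL F0F; set s := [seq (k, j) | k <- F, j <- index_enum 'I_r].
have us : uniq s.
  apply: allpairs_uniq; [exact: fset_uniq|exact: index_enum_uniq|].
  by move=> [k i] [l j] _ _ [-> ->].
have sL : {in s, forall p, Lam p.1}.
  by move=> _ /allpairsP[[k j] [/= kF _ ->]]; exact: FL.
have s0s : {subset s0 <= s}.
  move=> [k j] ks; apply/allpairsP; exists (k, j); split => //=.
    apply: (fsubsetP F0F); apply/imfsetP.
    by exists (k, j).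
  exact: mem_index_enum.
have small := Hs0 s us sL s0s.
pose h x := f x - \sum_(p <- s) L2dot f (translates p) * translates p x.
have h2 : @L2 R n h by apply: L2_sub_sum => //; exact: L2_translates.
apply: (@le_lt_trans _ _ (L2normsq (fun x => h (aff_act (a, 0) x)))).
  rewrite le_eqVlt; apply/orP; left; apply/eqP; congr L2normsq.
  apply/funext => x; rewrite /h /aff_act/= addr0; congr (_ - _).
  rewrite row_sumE.
  by apply: eq_bigr => -[].
apply: le_lt_trans (HC _ (L2_cmeasurable h2)) _.
by rewrite -(sqr_div_sqrt e C0) EFinM lte_pmul2l.
Qed.

End refinement.

Section symmetric_refinement.
Variables (R : realType) (n r : nat).
Variables (Gam : set (aff R n)) (G : set 'M[R]_n) (Lam : set 'cV[R]_n).
Variables (g : 'I_r.+1 -> 'M[R]_n) (a : 'M[R]_n).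
Hypothesis hGam : splitting_crystal_triple Gam G Lam.
Hypotheses (g_inj : injective g) (g_range : range g = G) (g_id : g ord0 = 1%:M).
Hypothesis ha : admissible Gam a.
Variable phi : 'cV[R]_n -> R[i].
Hypothesis phi2 : @L2 R n phi.
Local Notation Phi := (rotated g phi).
Local Notation gh i := (a *m g i *m invmx a).

(** The eigenvalue 0 is excluded. *)
Lemma admissible_unitmx : a \in unitmx.
Proof.
case: (boolP (a \in unitmx)) => // aNu; case: ha => /(_ 0) + _.
rewrite normr0 ltr10 => /(_ _)/notF [] //.
rewrite /eigenvalue /eigenspace raddf0 subr0 kermx_eq0 row_free_unit.
by rewrite map_unitmx.
Qed.

(** Conjugation by a preserves the point group, because a Gamma a^-1 is contained
    in Gamma. *)
Lemma conj_point i : exists l, gh i = g l.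
Proof.
have := ha.2 _ (Gam_point hGam g_range i).
by move=> /(lin_in_range hGam g_range)[l gl]; exists l; rewrite gl /= mulmxA.
Qed.

Lemma L2_rotated i : @L2 R n (Phi i).
Proof.
have := L2_aff (s := (invmx (g i), 0)) _ phi2.
rewrite unitmx_inv (g_unit hGam g_range) => /(_ isT).
by rewrite /aff_act /=; under eq_fun do rewrite addr0.
Qed.

(** The symmetry relation determines all rows from the first one, and the rows
    defined by it do satisfy their equations: the error in row i is the error in
    row 1 composed with the isometry g_i^-1, the index set F being replaced with
    g_{h_i}^-1 F. *)
Lemma symmetrized_refinement (c : 'cV[R]_n -> 'I_r.+1 -> R[i]) :
  row_refinement Lam a Phi phi c ->
  exists c' : 'cV[R]_n -> 'M[R[i]]_r.+1,
    [/\ refinement_equation Lam a Phi c', Gam_a_symmetry Lam a g c' &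
        finite_set [set k | Lam k /\ exists j, c k j <> 0] ->
        finitely_many_coefs Lam c'].
Proof.
move=> ref.
have au := admissible_unitmx.
have /choice[sigma sigmaE] := conj_point.
have /choice[rho rhoE] := fun i => point_group_perm hGam g_inj g_range (sigma i).
have gu := g_unit hGam g_range.
have ghu i : gh i \in unitmx by rewrite sigmaE gu.
have ghL i k : Lam k -> Lam (gh i *m k).
  by rewrite sigmaE; exact: (Lam_rot hGam g_range).
have ghLV i k : Lam k -> Lam (invmx (gh i) *m k).
  by rewrite sigmaE; exact: (Lam_rotV hGam g_range).
exists (fun k => \matrix_(i, j) c (invmx (gh i) *m k) (rho i j)).
have gh0 : gh ord0 = 1%:M by rewrite g_id mulmx1 mulmxV.
have rho0 j : rho ord0 j = j.
  by apply: g_inj; rewrite rhoE -sigmaE gh0 invmx1 mul1mx.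
split.
- move=> i e e0.
  have [C C0 HC] := L2normsq_aff (s := (invmx (g i), 0)) (etrans (unitmx_inv _) (gu i)).
  have e'0 : 0 < e / Num.sqrt C by rewrite divr_gt0// sqrtr_gt0.
  have [F0 [F0L HF0]] := ref _ e'0.
  exists [fset gh i *m k | k in F0]%fset; split.
    by move=> _ /= /imfsetP[k /= kF ->]; apply: ghL; exact: F0L.
  move=> F FL F0F; pose F1 := [fset invmx (gh i) *m k | k in F]%fset.
  have F1L : [set` F1] `<=` Lam.
    by move=> _ /= /imfsetP[k /= kF ->]; apply: ghLV; exact: FL.
  have F01 : (F0 `<=` F1)%fset.
    apply/fsubsetP => k kF; apply/imfsetP; exists (gh i *m k) => /=.
      by apply: (fsubsetP F0F); apply/imfsetP; exists k.
    by rewrite mulKmx.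
  pose h x := phi x - \sum_(k <- F1) \sum_j c k j * Phi j (a *m x - k).
  have small : (L2normsq h < ((e / Num.sqrt C) ^+ 2)%:E)%E := HF0 F1 F1L F01.
  have h2 : @L2 R n h.
    have -> : h = fun x => phi x -
        \sum_(p <- [seq (k, j) | k <- F1, j <- index_enum 'I_r.+1])
          c p.1 p.2 * translates Phi p (aff_act (a, 0) x).
      by apply/funext => x; rewrite /h /aff_act/= addr0 row_sumE.
    apply: (@L2_sub_sum _ _ _ _ _ (fun p x => translates Phi p (aff_act (a, 0) x))) => // p.
    by apply: L2_aff => //; apply: L2_translates; exact: L2_rotated.
  apply: (@le_lt_trans _ _ (L2normsq (fun x => h (aff_act (invmx (g i), 0) x)))).
    rewrite le_eqVlt; apply/orP; left; apply/eqP; congr L2normsq.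
    apply/funext => x; rewrite /h /aff_act/= addr0; congr (_ - _).
    rewrite big_imfset /=; last first.
      by move=> k l _ _ /(congr1 (mulmx (gh i))); rewrite !mulKVmx.
    apply: eq_bigr => k _.
    rewrite [RHS](reindex_inj (@perm_inj _ (rho i))); apply: eq_bigr => j _.
    rewrite mxE /rotated; congr (_ * phi _).
    (* B is g_{rho_i j}; both sides evaluate phi at g_j^-1 (a x - k). *)
    rewrite rhoE -sigmaE; set B := invmx (gh i) *m g j.
    have Bu : B \in unitmx by rewrite unitmx_mul unitmx_inv ghu gu.
    have -> : a *m (invmx (g i) *m x) = invmx (gh i) *m (a *m x).
      rewrite -[LHS](mulKmx (ghu i)); congr (_ *m _).
      by rewrite -!mulmxA mulKmx// mulKVmx.
    rewrite -mulmxBr -[LHS](mulKmx Bu) /B -!mulmxA.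
    by rewrite mulKVmx.
  apply: le_lt_trans (HC _ (L2_cmeasurable h2)) _.
  by rewrite -(sqr_div_sqrt e C0) EFinM lte_pmul2l.
- exists rho; split=> [i j|i j k Lk]; first by rewrite rhoE sigmaE.
  by rewrite !mxE gh0 invmx1 mul1mx rho0.
- move=> fin.
  apply: (@sub_finite_set _ _ (\bigcup_(i in [set: 'I_r.+1])
      mulmx (gh i) @` [set k | Lam k /\ exists j, c k j <> 0])).
    move=> k [Lk ck].
    have [i [j cij]] : exists i j, c (invmx (gh i) *m k) (rho i j) <> 0.
      apply: contrapT => H; apply: ck; apply/matrixP => i j; rewrite !mxE.
      by apply: contrapT => cij; apply: H; exists i, j.
    exists i => //; exists (invmx (gh i) *m k); last by rewrite mulKVmx.
    by split; [exact: ghLV|exists (rho i j)].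
  by apply: bigcup_finite => // i _; exact: finite_image.
Qed.

End symmetric_refinement.

(** * Spaces generated by a function *)

Section spaces.
Local Open Scope complex_scope.
Variables (R : realType) (d : nat).
Local Notation fn := ('cV[R]_d.+1 -> R[i]).
Variable a : 'M[R]_d.+1.
Hypothesis au : a \in unitmx.

Lemma Dop_lin (f : fn) :
  Dop (aff_lin a) f = fun x => ((Num.sqrt `|\det a|)^-1)%:C * f (invmx a *m x).
Proof.
by apply/funext => x; rewrite /Dop /aff_act /= mulmx0 oppr0 addr0.
Qed.

Lemma closed_subspaceZ (V : set fn) (c : R[i]) (f : fn) :
  closed_subspace V -> V f -> V (fun x => c * f x).
Proof.
move=> [_ V0 VD _] Vf; have := VD c _ _ Vf V0.
by under eq_fun do rewrite addr0.
Qed.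

Lemma dilation_mem (V : set fn) (f : fn) : closed_subspace V ->
  V (Dop (aff_lin a) f) <-> V (fun x => f (invmx a *m x)).
Proof.
move=> cV; rewrite Dop_lin; set c := (_^-1)%:C.
have c0 : c != 0.
  rewrite (_ : 0 = 0%:C)// (inj_eq (@complexI R)) invr_eq0 sqrtr_eq0 -ltNge.
  by rewrite normr_gt0 -unitfE -unitmxE.
split=> [/(closed_subspaceZ c^-1 cV)|]; last exact: closed_subspaceZ.
by under eq_fun do rewrite (mulKf c0).
Qed.

(** Reindexing with a ^ (j + 1) = a ^ j a: the generated spaces obey the dilation
    rule up to the normalizing scalar of D_a. *)
Lemma generated_spaces_shift (Gam : set (aff R d.+1)) (phi : fn) j (f : fn) :
  generated_spaces Gam a phi (j + 1) f <->
  generated_spaces Gam a phi j (fun x => f (invmx a *m x)).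
Proof.
have aj : a ^ (j + 1) = a ^ j *m a by rewrite exprzDr ?expr1z// unitmxE.
split=> -[f0 f0V E]; exists f0 => //; first rewrite -E; apply/funext => x.
  by rewrite aj -mulmxA mulKVmx.
by have := congr1 (@^~ (a *m x)) E; rewrite /= mulKmx// aj -mulmxA.
Qed.

(** V_0 is prescribed by the orbit, and the dilation rule determines V_(j+1) from
    V_j and conversely, so induction in both directions on the integers leaves
    no freedom. *)
Lemma MRA_generated (Gam Lam' : set (aff R d.+1)) (N : nat) (Phi : 'I_N -> fn)
    (phi : fn) (W : int -> set fn) :
  orbit_family Lam' Phi = [set Dop s phi | s in Gam] ->
  is_MRA Lam' a Phi W -> W = generated_spaces Gam a phi.
Proof.
move=> orb mra.
have WS j f : W (j + 1) f <-> W j (fun x => f (invmx a *m x)).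
  rewrite (MRA_dilation mra) /preimage /=.
  exact: (dilation_mem _ (MRA_closed mra j)).
have W0 : W 0 = generated_spaces Gam a phi 0.
  rewrite (MRA_span mra) orb; apply/seteqP; split=> f.
    by move=> fV; exists f => //; apply/funext => x; rewrite expr0z mul1mx.
  move=> [f0 f0V <-]; rewrite (_ : (fun _ => _) = f0)//.
  by apply/funext => x; rewrite expr0z mul1mx.
have up j : W j = generated_spaces Gam a phi j -> W (j + 1) = generated_spaces Gam a phi (j + 1).
  by move=> E; apply/seteqP; split=> f; rewrite WS generated_spaces_shift E.
have down j : W (j + 1) = generated_spaces Gam a phi (j + 1) -> W j = generated_spaces Gam a phi j.
  move=> E; apply/predeqP => f.
  have fE : (fun x => f (a *m (invmx a *m x))) = f.
    by apply/funext => x; rewrite mulKVmx.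
  have := WS j (fun y => f (a *m y)).
  have := generated_spaces_shift Gam phi j (fun y => f (a *m y)).
  by rewrite E fE => -> ->.
have int_succ (k : nat) : k.+1%:Z = k%:Z + 1 by rewrite -addn1 PoszD.
apply/funext; elim/int_ind => [//|k IH|k IH]; first by rewrite int_succ; exact: up.
by apply: down; rewrite int_succ opprD subrK.
Qed.

End spaces.

(** * Crystal MRAs and classical MRAs *)

Theorem corollary3p12 (R : realType) (d r : nat)
  (Gam : set (aff R d.+1)) (G : set 'M[R]_d.+1) (Lam : set 'cV[R]_d.+1)
  (g : 'I_r.+1 -> 'M[R]_d.+1) (a : 'M[R]_d.+1) (phi : 'cV[R]_d.+1 -> R[i])
  (hGam : splitting_crystal_triple Gam G Lam)
  (hg_inj : injective g) (hg_range : range g = G) (hg_id : g ord0 = 1%:M)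
  (ha : admissible Gam a)
  (hdig : admits_tiling_digits Lam a)
  (hphi : @L2 R d.+1 phi)
  (hfin : (exists c, refinement_equation Lam a (rotated g phi) c) ->
          exists2 c, finitely_many_coefs Lam c &
                     refinement_equation Lam a (rotated g phi) c) :
  is_MRA Gam a (fun _ : 'I_1 => phi) (generated_spaces Gam a phi) <->
  ((exists W, is_MRA (translations Lam) a (rotated g phi) W) /\
   (exists c, [/\ finitely_many_coefs Lam c,
                  refinement_equation Lam a (rotated g phi) c &
                  Gam_a_symmetry Lam a g c])).
Proof.
have au := admissible_unitmx ha.
have Phi2 := L2_rotated hGam hg_range hphi.
have orbE := orbit_family_rotated hGam hg_range phi.
have onE := orthonormal_orbit_rotated hGam hg_inj hg_range phi.
split=> [mra|[[W mra] _]]; last first.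
  have WE : W = generated_spaces Gam a phi.
    by apply: (MRA_generated au _ mra); rewrite -orbE orbit_family1.
  rewrite -WE; case: mra => *; split => //; first exact/onE.
  by rewrite orbE.
have mraL : is_MRA (translations Lam) a (rotated g phi) (generated_spaces Gam a phi).
  by case: mra => *; split => //; [exact/onE|rewrite -orbE].
split; first by exists (generated_spaces Gam a phi).
have phiV0 : generated_spaces Gam a phi 0 phi.
  rewrite (MRA_span mra); split=> // e e0; exists phi.
    exists 1%N, (fun=> 1), (fun=> phi); split => [_|].
      exists ord0, (aff_one _ _); split.
        by case: hGam => -[] [].
      by rewrite /aff_one Dop_translation; apply/funext => x; rewrite subr0.
    by apply/funext => x; rewrite big_ord1 mul1r.
  rewrite /L2normsq integral0_eq ?lte_fin ?exprn_gt0// => x _.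
  by rewrite subrr /= expr0n addr0.
have [f fV phiE] : generated_spaces Gam a phi (0 + 1) phi := MRA_nested mra phiV0.
rewrite add0r expr1z -orbit_family1 orbE in phiE fV.
have := row_refinement_expansion Phi2 au (MRA_orthonormal mraL) fV.
rewrite phiE => /(symmetrized_refinement hGam hg_inj hg_range hg_id ha hphi).
move=> [c0 [ref0 _ _]].
(* The finite solution need not be symmetric, but its first row can be
   symmetrized, and this keeps it finite. *)
have [c1 fin1 ref1] := hfin (ex_intro _ c0 ref0).
have row1 : row_refinement Lam a (rotated g phi) phi (fun k j => c1 k ord0 j).
  have := ref1 ord0; rewrite (_ : rotated g phi ord0 = phi)//.
  by apply/funext => x; rewrite /rotated hg_id invmx1 mul1mx.
have [c [ref sym fin]] :=
  symmetrized_refinement hGam hg_inj hg_range hg_id ha hphi row1.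
exists c; split => //; apply: fin; apply: sub_finite_set fin1 => k [Lk [j cj]].
by split => // E; apply: cj; rewrite E mxE.
Qed.
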